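(* For every $\varepsilon>0$ and every $H>0$, the function $d^{2H}$, where $d$ is the product geodesic distance on the cylinder $\mathbb{S}^1\times\,]0,\varepsilon[$, is not a negative definite kernel; hence there exists no $H$-fractional Brownian field indexed by $\mathbb{S}^1\times\,]0,\varepsilon[$. In other terms, the fractional index of the cylinder satisfies $$\beta_{\mathbb{S}^1\times\,]0,\varepsilon[}=0 .$$
   Context: $]a,b[$ denotes an open interval. $\mathbb{S}^1$ is the circle of length $2\pi$, with angular coordinate $\theta\in[0,2\pi[$ and geodesic distance $d_{\mathbb{S}^1}(\theta_1,\theta_2)=\min(|\theta_1-\theta_2|,2\pi-|\theta_1-\theta_2|)$. The cylinder $\mathbb{S}^1\times\mathbb{R}$ carries the Riemannian product metric $d\theta^2+dz^2$, whose geodesic distance is $$d((\theta_1,z_1),(\theta_2,z_2))=\left(d_{\mathbb{S}^1}(\theta_1,\theta_2)^2+|z_1-z_2|^2\right)^{1/2};$$ $\mathbb{S}^1\times\,]0,\varepsilon[$ is endowed with the restriction of this distance (which coincides with the geodesic distance of the metric $d\theta^2+dz^2$ on $\mathbb{S}^1\times\,]0,\varepsilon[$). A symmetric function $f:S\times S\to\mathbb{R}$ on a set $S$ is a negative definite kernel if for every $n$, every $x_1,\dots,x_n\in S$ and every $c_1,\dots,c_n\in\mathbb{R}$ with $\sum_{i=1}^n c_i=0$, one has $\sum_{i,j=1}^n c_ic_jf(x_i,x_j)\le 0$. Given a metric space $(E,d)$ and $H>0$, an $H$-fractional Brownian field indexed by $E$ is a centred, real-valued Gaussian random field $(X_x)_{x\in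 E}$ such that $\mathbb{E}(X_x-X_y)^2=[d(x,y)]^{2H}$ for all $x,y\in E$. The fractional index of a metric space $(E,d)$ is the number $\beta_E\in[0,+\infty]$ (known to exist) such that for every $H>0$, the function $d^{2H}$ is a negative definite kernel if and only if $2H\le\beta_E$. *)

(* Defs.v *)
From HB Require Import structures.
From mathcomp Require Import all_boot all_order all_algebra.
From mathcomp Require Import ring lra.
From mathcomp Require Import all_classical all_reals all_analysis.

Set Implicit Arguments.
Unset Strict Implicit.
Unset Printing Implicit Defensive.

Import Order.TTheory GRing.Theory Num.Theory.
Import numFieldNormedType.Exports.

Local Open Scope classical_set_scope.
Local Open Scope ring_scope.

Definition negative_definite_kernel (R : realType) (S : Type)
    (f : S -> S -> R) : Prop :=
  (forall x y : S, f x y = f y x) /\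
  (forall (n : nat) (x : 'I_n -> S) (c : 'I_n -> R),
     \sum_(i < n) c i = 0 ->
     \sum_(i < n) \sum_(j < n) c i * c j * f (x i) (x j) <= 0).

(* The Dirac mass stands for the degenerate Gaussian law N(m, 0), because
   [normal_prob m 0] is by convention the uniform law on [0, 1].  The laws are
   compared on measurable sets only: a pushforward is not meaningful on the
   others. *)
Definition gaussian_law (R : realType) (mu : set R -> \bar R) : Prop :=
  exists m s : R, 0 <= s /\
    forall A : set R, measurable A ->
      mu A = if s == 0 then \d_m A else normal_prob m s A.

Definition gaussian_field (R : realType) (E : Type) (d : measure_display)
    (T : measurableType d) (P : probability T R) (X : E -> {RV P >-> R}) : Prop :=
  forall (n : nat) (x : 'I_n -> E) (c : 'I_n -> R),
    gaussian_law (pushforward P (fun w => \sum_(i < n) c i * X (x i) w)).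

Definition fractional_brownian_field (R : realType) (E : metricType R) (H : R)
    (d : measure_display) (T : measurableType d) (P : probability T R)
    (X : E -> {RV P >-> R}) : Prop :=
  [/\ gaussian_field X,
      forall x : E, ('E_P[X x] = 0)%E &
      forall x y : E,
        ('E_P[fun w => ((X x w - X y w) ^+ 2)%R]
           = (mdist x y `^ (2 * H))%:E)%E].

Definition is_fractional_index (R : realType) (E : metricType R)
    (beta : \bar R) : Prop :=
  (0 <= beta)%E /\
  forall H : R, 0 < H ->
    (negative_definite_kernel (fun x y : E => mdist x y `^ (2 * H))
       <-> ((2 * H)%:E <= beta)%E).

(* [beta] is determined by [is_fractional_index]; the default value -oo lies
   outside the range [0, +oo], so [fractional_index E = b] with [b] in that
   range holds exactly when [b] satisfies the specification. *)
Definition fractional_index (R : realType) (E : metricType R) : \bar R :=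
  xget -oo%E [set beta | is_fractional_index E beta].

Definition circle_dist (R : realType) (a b : R) : R :=
  Num.min `|a - b| (2 * pi - `|a - b|).

(* Points are pairs (theta, z) of coordinates. *)
Definition cylinder_dist (R : realType) (p q : R * R) : R :=
  Num.sqrt (circle_dist p.1 q.1 ^+ 2 + `|p.2 - q.2| ^+ 2).

Definition cylinder (R : realType) (eps : R) : Type :=
  {p : R * R | (p.1 \in `[0, 2 * pi[) && (p.2 \in `]0, eps[)}.

HB.instance Definition _ (R : realType) (eps : R) :=
  Choice.copy (cylinder eps)
    {p : R * R | (p.1 \in `[0, 2 * pi[) && (p.2 \in `]0, eps[)}.

Lemma circle_dist_ge0 (R : realType) (a b : R) :
  a \in `[0, 2 * pi[ -> b \in `[0, 2 * pi[ -> 0 <= circle_dist a b.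
Proof.
rewrite !in_itv/= => /andP[? ?] /andP[? ?]; rewrite /circle_dist le_min normr_ge0/=.
by case: (ger0P (a - b)) => ?; lra.
Qed.

Lemma circle_dist_triangle (R : realType) (a b c : R) :
  a \in `[0, 2 * pi[ -> b \in `[0, 2 * pi[ -> c \in `[0, 2 * pi[ ->
  circle_dist a c <= circle_dist a b + circle_dist b c.
Proof.
rewrite !in_itv/= => /andP[? ?] /andP[? ?] /andP[? ?]; rewrite /circle_dist.
rewrite !minEle.
case: (ger0P (a - b)) => ?; case: (ger0P (b - c)) => ?;
case: (ger0P (a - c)) => ?; do 3 case: ifPn; rewrite -?ltNge => ? ? ?; lra.
Qed.

Lemma circle_dist_sym (R : realType) (a b : R) :
  circle_dist a b = circle_dist b a.
Proof. by rewrite /circle_dist distrC. Qed.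

Lemma cylinder_distxx (R : realType) (eps : R) (p : cylinder eps) :
  cylinder_dist (val p) (val p) = 0.
Proof.
rewrite /cylinder_dist /circle_dist !subrr !normr0 subr0.
by rewrite min_l ?mulr_ge0 ?pi_ge0// expr0n/= addr0 sqrtr0.
Qed.

Lemma cylinder_dist_positivity (R : realType) (eps : R) (p q : cylinder eps) :
  cylinder_dist (val p) (val q) = 0 -> p = q.
Proof.
move=> /eqP; rewrite /cylinder_dist sqrtr_eq0 => h; apply: val_inj.
case: p q h => -[a z] /= /andP[ha _] [[b t] /= /andP[hb _]] h.
have : circle_dist a b ^+ 2 + `|z - t| ^+ 2 == 0.
  by rewrite eq_le h addr_ge0// sqr_ge0.
rewrite paddr_eq0 ?sqr_ge0// !sqrf_eq0 normr_eq0 subr_eq0 => /andP[/eqP cab /eqP ->].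
congr pair; apply/eqP; rewrite -subr_eq0 -normr_eq0.
move: ha hb cab; rewrite !in_itv/= /circle_dist minEle => /andP[? ?] /andP[? ?].
case: ifP => _ /eqP //.
by case: (ger0P (a - b)) => ? /eqP ?; exfalso; lra.
Qed.

Lemma cylinder_dist_sym (R : realType) (eps : R) (p q : cylinder eps) :
  cylinder_dist (val p) (val q) = cylinder_dist (val q) (val p).
Proof. by rewrite /cylinder_dist circle_dist_sym distrC. Qed.

Lemma minkowski2 (R : realType) (a b c d : R) :
  Num.sqrt ((a + b) ^+ 2 + (c + d) ^+ 2)
    <= Num.sqrt (a ^+ 2 + c ^+ 2) + Num.sqrt (b ^+ 2 + d ^+ 2).
Proof.
set s := Num.sqrt (a ^+ 2 + _); set t := Num.sqrt (b ^+ 2 + _).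
have s0 : 0 <= s by exact: sqrtr_ge0.
have t0 : 0 <= t by exact: sqrtr_ge0.
have s2 : s ^+ 2 = a ^+ 2 + c ^+ 2 by rewrite sqr_sqrtr// addr_ge0// sqr_ge0.
have t2 : t ^+ 2 = b ^+ 2 + d ^+ 2 by rewrite sqr_sqrtr// addr_ge0// sqr_ge0.
have st : a * b + c * d <= s * t.
  apply: (le_trans (ler_norm _)).
  rewrite -(@ler_pXn2r _ 2)// ?nnegrE ?mulr_ge0//.
  rewrite real_normK ?num_real// exprMn s2 t2 -subr_ge0.
  rewrite (_ : _ - _ = (a * d - b * c) ^+ 2) ?sqr_ge0//; ring.
rewrite -(@ler_pXn2r _ 2)// ?nnegrE ?addr_ge0 ?sqrtr_ge0//.
rewrite sqr_sqrtr ?addr_ge0 ?sqr_ge0// -subr_ge0.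
rewrite (_ : _ - _ = (s ^+ 2 - (a ^+ 2 + c ^+ 2)) + (t ^+ 2 - (b ^+ 2 + d ^+ 2))
  + 2 * (s * t - (a * b + c * d))); last by ring.
by rewrite s2 t2 !subrr !add0r mulr_ge0// subr_ge0.
Qed.

Lemma cylinder_dist_triangle (R : realType) (eps : R) (q p r : cylinder eps) :
  cylinder_dist (val p) (val r)
    <= cylinder_dist (val p) (val q) + cylinder_dist (val q) (val r).
Proof.
case: p q r => -[a x] /= /andP[ha _] [[b y] /= /andP[hb _]] [[c z] /= /andP[hc _]].
rewrite /cylinder_dist/=; apply: le_trans (minkowski2 _ _ _ _).
rewrite ler_sqrt ?addr_ge0 ?sqr_ge0// lerD//.
  rewrite ler_pXn2r// ?nnegrE ?addr_ge0 ?circle_dist_ge0//.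
  exact: circle_dist_triangle.
rewrite ler_pXn2r// ?nnegrE ?addr_ge0//.
by rewrite (_ : x - z = (x - y) + (y - z)) ?ler_normD//; ring.
Qed.

HB.instance Definition _ (R : realType) (eps : R) :=
  isMetric.Build R (cylinder eps) (@cylinder_distxx R eps)
    (@cylinder_dist_positivity R eps) (@cylinder_dist_sym R eps)
    (@cylinder_dist_triangle R eps).

(* Main.v *)
Require Import Defs.
From HB Require Import structures.
From mathcomp Require Import all_boot all_order all_algebra.
From mathcomp Require Import ring lra.
From mathcomp Require Import all_classical all_reals all_analysis measurable_realfun.

Set Implicit Arguments.
Unset Strict Implicit.
Unset Printing Implicit Defensive.

Import Order.TTheory GRing.Theory Num.Theory.
Import numFieldNormedType.Exports.
Local Open Scope ring_scope.

(** The kernel is tested on pairs of antipodal dipoles spread vertically.  Take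
   heights z_0, ..., z_(N-1) and, above each of them, the four points of angle
   0, t, pi, pi + t with weights 1, -1, 1, -1.  With p_kl = (z_k - z_l)^2, the
   quadratic form of d^(2H) equals 4 (C - L), where
     L = sum_kl (t^2 + p_kl)^H - p_kl^H
   is the interaction inside each dipole column, and
     C = sum_kl (pi^2 + p_kl)^H - ((pi - t)^2 + p_kl)^H
   is the interaction between the two antipodal columns.  Negative definiteness
   would force C <= L (lemma [negative_definite_dipole_energy]).

   On the circle alone, with N = 1, C is of order t because the distance to a
   point has a corner at its antipode, while L is of order t^(2H).  This
   already contradicts C <= L when 2H > 1: take t = pi / 2.  When 2H <= 1, L wins,
   and the vertical direction is used to smooth out its singularity while the
   corner persists along a whole vertical line.  With heights t, 2t, ..., Nt,
   where N t = e / 2 is fixed, C is at least a constant times N^2 t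
   (lemma [antipodal_gain_ge]), whereas the row sums of L are
   t^(2H) sum_j ((1 + j^2)^H - j^(2H)) = O(t^(2H) N^H), the increments being
   O(j^(2H - 2)) (lemma [sum_powR_incr_le]).  So L / C is at most of order
   (t^2 N)^H / (N t), that is, N^(-H), and C > L for large N.

   A fractional Brownian field would make d^(2H) negative definite, because the
   quadratic form is the expectation of -2 (sum_i c_i X_i)^2.  Finally a positive
   fractional index would make d^(2H) negative definite for a small H > 0. *)

(** * Elementary inequalities on real powers *)

(** A weak form of the tangent inequality for the concave map x |-> x^H: with
   y = H (1 - B / A), one has (B / A)^H <= exp (- y) <= 1 / (1 + y) <= 1 - y / 2,
   the last step because 0 <= y <= 1. *)
Lemma powR_sub_ge (R : realType) (H A B : R) : 0 < H <= 1 -> 0 < B <= A -> 1 <= A ->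
  H * (A - B) / (2 * A) <= A `^ H - B `^ H.
Proof.
move=> /andP[H0 H1] /andP[B0 BA] A1.
have A0 : 0 < A by lra.
have r0 : 0 < B / A by rewrite divr_gt0.
have r1 : B / A <= 1 by rewrite ler_pdivrMr// mul1r.
set y := H * (1 - B / A).
have y0 : 0 <= y by rewrite mulr_ge0 ?subr_ge0 // ltW.
have y1 : y <= 1 by rewrite /y; nra.
have rH : (B / A) `^ H <= 1 - y / 2.
  have h1 : (B / A) `^ H <= expR (- y).
    rewrite /powR gt_eqF// ler_expR /y -mulrN ler_pM2l//.
    have := expR_ge1Dx (ln (B / A)); rewrite lnK// => h.
    lra.
  apply: (le_trans h1).
  rewrite expRN; apply: (@le_trans _ _ (1 + y)^-1).
    by rewrite lef_pV2 ?posrE ?expR_gt0 ?expR_ge1Dx//; lra.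
  by rewrite invf_ple ?posrE; [|lra|lra]; rewrite -div1r ler_pdivrMr; nra.
have BE : B `^ H = A `^ H * (B / A) `^ H.
  by rewrite -powRM 1?ltW// mulrCA divff ?gt_eqF// mulr1.
have AH : 1 <= A `^ H by rewrite -(powRr0 A) ler_powR// ltW.
have -> : H * (A - B) / (2 * A) = y / 2 by rewrite /y; field; lra.
by rewrite BE; nra.
Qed.

(** The terms are dominated by the increments of - 2 / sqrt x, so the sum
   telescopes. *)
Lemma sum_inv_mul_sqrt_le3 (R : rcfType) (n : nat) :
  \sum_(0 <= j < n) (j.+1%:R * Num.sqrt j.+1%:R)^-1 <= 3 :> R.
Proof.
case: n => [|n]; first by rewrite big_geq.
apply: (@le_trans _ _ (3 - 2 / Num.sqrt n.+1%:R)); last first.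
  by rewrite lerBlDr lerDl divr_ge0// sqrtr_ge0.
elim: n => [|n IHn]; first by rewrite big_nat1 sqrtr1; lra.
rewrite big_nat_recr//=; apply: (le_trans (lerD IHn (lexx _))).
have a2 : Num.sqrt n.+1%:R ^+ 2 = n.+1%:R :> R by rewrite sqr_sqrtr ?ler0n.
have b2 : Num.sqrt n.+2%:R ^+ 2 = n.+2%:R :> R by rewrite sqr_sqrtr ?ler0n.
have a0 : 0 < Num.sqrt n.+1%:R :> R by rewrite sqrtr_gt0 ltr0n.
have b0 : 0 < Num.sqrt n.+2%:R :> R by rewrite sqrtr_gt0 ltr0n.
rewrite -[X in _ + (X * _)^-1]b2.
have {a2 b2} : Num.sqrt n.+2%:R ^+ 2 = Num.sqrt n.+1%:R ^+ 2 + 1 :> R.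
  by rewrite a2 b2 -[n.+2]addn1 natrD.
move: (Num.sqrt (n.+1%:R : R)) a0 (Num.sqrt (n.+2%:R : R)) b0 => a a0 b b0 ab.
have ba : b - a = (a + b)^-1.
  apply: (@mulIf _ (a + b)); first by lra.
  by rewrite mulVf; [|lra]; rewrite (_ : _ * _ = b ^+ 2 - a ^+ 2); [lra|ring].
rewrite -subr_ge0.
have -> : 3 - 2 / b - (3 - 2 / a + (b ^+ 2 * b)^-1) =
          (2 * b ^+ 2 * (b - a) - a) / (a * b ^+ 3).
  by field; lra.
rewrite divr_ge0 ?mulr_ge0 ?exprn_ge0 1?ltW//.
have -> : 2 * b ^+ 2 * (b - a) - a = (2 * b ^+ 2 - a * (a + b)) / (a + b).
  by rewrite ba; field; lra.
by rewrite divr_gt0//; nra.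
Qed.

(** The increment is at most x^(2H - 2).  Spending a factor y^H in exchange for
   x^H turns this into x^(-3/2), which is summable with a bound that does not
   depend on H. *)
Lemma powR_incr_le (R : realType) (H x y : R) : 0 < H <= 2^-1 -> 1 <= x <= y ->
  (1 + x ^+ 2) `^ H - (x ^+ 2) `^ H <= y `^ H / (x * Num.sqrt x).
Proof.
move=> /andP[H0 H1] /andP[x1 xy].
have x0 : 0 < x by lra.
have s0 : 0 < Num.sqrt x by rewrite sqrtr_gt0.
have sx : Num.sqrt x ^+ 2 = x by rewrite sqr_sqrtr ?ltW.
have -> : 1 + x ^+ 2 = x ^+ 2 * (1 + x ^- 2) by field; lra.
have i0 : 0 < x ^- 2 by rewrite invr_gt0 exprn_gt0.
rewrite powRM ?sqr_ge0 ?addr_ge0 ?(ltW i0)//.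
have h1 : (1 + x ^- 2) `^ H <= 1 + x ^- 2 by apply: ler1_powR; lra.
have h2 : (x ^+ 2) `^ H <= y `^ H * Num.sqrt x.
  rewrite expr2 powRM ?(ltW x0)// ler_pM ?powR_ge0//.
    by apply: ge0_ler_powR; rewrite ?nnegrE; lra.
  by rewrite -powR12_sqrt ?(ltW x0)// ler_powR.
have p0 := powR_ge0 (x ^+ 2) H.
apply: (@le_trans _ _ ((x ^+ 2) `^ H * x ^- 2)); first by nra.
apply: (le_trans (ler_wpM2r (ltW i0) h2)).
suff -> : y `^ H / (x * Num.sqrt x) = y `^ H * Num.sqrt x * x ^- 2 by [].
by move: (Num.sqrt x) {h2} s0 sx => s s0 <-; field; lra.
Qed.

(** Each distance to k is attained at most twice, once on either side; the
   truncated differences add up to the distance of k and l. *)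
Lemma row_sum_dist_le (R : numDomainType) (N : nat) (g : nat -> R) (k : nat) :
  (forall j, 0 <= g j) -> (k < N)%N ->
  \sum_(0 <= l < N) g ((k - l) + (l - k))%N <= 2 * \sum_(0 <= j < N) g j.
Proof.
move=> g0 kN.
have mono m : (m <= N)%N -> \sum_(0 <= j < m) g j <= \sum_(0 <= j < N) g j.
  by move=> mN; rewrite [leRHS](big_cat_nat _ mN)//= lerDl sumr_ge0.
rewrite (big_cat_nat _ (ltnW kN))//= mulrDl mul1r lerD//.
  rewrite big_nat_rev/= add0n.
  apply: le_trans (mono k.+1 kN).
  rewrite [leRHS]big_nat_recl//= -[leLHS]add0r lerD//.
  rewrite ler_sum_nat// => i /andP[_ ik].
  rewrite subKn// (_ : (k - i.+1 - k)%N = 0%N) ?addn0//.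
  by apply/eqP; rewrite subn_eq0 leq_subr.
rewrite -{1}(add0n k) big_addn.
apply: le_trans (mono (N - k)%N (leq_subr _ _)).
rewrite ler_sum_nat// => i _.
by rewrite addnK (_ : (k - (i + k))%N = 0%N) ?add0n//; apply/eqP; rewrite subn_eq0 leq_addl.
Qed.

(** * Antipodal dipoles and their energy *)

Lemma negative_definite_finType (R : realType) (S : Type) (f : S -> S -> R)
    (I : finType) (x : I -> S) (c : I -> R) :
  negative_definite_kernel f -> \sum_i c i = 0 ->
  \sum_i \sum_j c i * c j * f (x i) (x j) <= 0.
Proof.
move=> [_ nd] c0.
have enumE (F : I -> R) : \sum_(i < #|I|) F (enum_val i) = \sum_i F i.
  by rewrite -(big_enum_val F); apply: eq_bigl => i.
have := nd #|I| (x \o enum_val) (c \o enum_val).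
rewrite enumE => /(_ c0); congr (_ <= _).
rewrite -(enumE (fun i => \sum_j _)); apply: eq_bigr => i _.
by rewrite -(enumE (fun j => c (enum_val i) * c j * f (x (enum_val i)) (x j))).
Qed.

Definition antipodal_dipoles (R : realType) (t : R) (ab : bool * bool) : R :=
  (if ab.1 then pi else 0) + (if ab.2 then t else 0).

Lemma circle_dist_antipodal_dipoles (R : realType) (t : R) (u v : bool * bool) :
  0 < t < pi ->
  circle_dist (antipodal_dipoles t u) (antipodal_dipoles t v) =
    if u.1 == v.1 then (if u.2 == v.2 then 0 else t)
    else (if u.2 == v.2 then pi else pi - t).
Proof.
case: u v => [[] []] [[] []] /andP[t0 tpi];
  rewrite /circle_dist /antipodal_dipoles/= ?addr0 ?add0r minEle;
  by case: ger0P => ?; case: ifP => /idP ?; lra.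
Qed.

Lemma antipodal_dipoles_in (R : realType) (t : R) (u : bool * bool) :
  0 < t < pi -> antipodal_dipoles t u \in `[0, 2 * pi[.
Proof.
by case: u => [[] []] /andP[t0 tpi]; rewrite /antipodal_dipoles in_itv/=; lra.
Qed.

Lemma sqrt_powR2 (R : realType) (x H : R) : 0 <= x ->
  Num.sqrt x `^ (2 * H) = x `^ H.
Proof.
by move=> x0; rewrite powRrM -[2]/(2%:R) powR_mulrn ?sqrtr_ge0// sqr_sqrtr.
Qed.

(** The quadratic form at the points (antipodal_dipoles t (a, b), z_k) with
   weights (-1)^b is four times the left-hand side minus the right-hand side. *)
Lemma negative_definite_dipole_energy (R : realType) (eps H t : R) (N : nat)
    (z : 'I_N -> R) :
  negative_definite_kernel (fun x y : cylinder eps => mdist x y `^ (2 * H)) ->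
  0 < t < pi -> (forall k, 0 < z k < eps) ->
  \sum_(k < N) \sum_(l < N) ((pi ^+ 2 + (z k - z l) ^+ 2) `^ H
      - ((pi - t) ^+ 2 + (z k - z l) ^+ 2) `^ H)
  <= \sum_(k < N) \sum_(l < N) ((t ^+ 2 + (z k - z l) ^+ 2) `^ H
      - ((z k - z l) ^+ 2) `^ H).
Proof.
move=> nd tpi zeps.
have P (i : 'I_N * (bool * bool)) :
    (antipodal_dipoles t i.2 \in `[0, 2 * pi[) && (z i.1 \in `]0, eps[).
  by rewrite antipodal_dipoles_in//= in_itv/=; apply: zeps.
pose x i : cylinder eps := exist _ (antipodal_dipoles t i.2, z i.1) (P i).
pose c (i : 'I_N * (bool * bool)) : R := if i.2.2 then -1 else 1.
have c0 : \sum_i c i = 0.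
  rewrite -(pair_bigA _ (fun k ab => c (k, ab)))/= big1// => k _.
  rewrite -(pair_bigA _ (fun a b => c (k, (a, b))))/= big1// => a _.
  by rewrite big_bool /c/=; lra.
have sum4 (F : bool * bool -> R) : \sum_u F u =
    F (true, true) + F (true, false) + (F (false, true) + F (false, false)).
  rewrite (eq_bigr (fun u => F (u.1, u.2))); last by case.
  by rewrite -(pair_bigA _ (fun a b => F (a, b)))/= !big_bool.
have := negative_definite_finType x nd c0.
rewrite -(pair_bigA _ (fun k u =>
  \sum_j c (k, u) * c j * mdist (x (k, u)) (x j) `^ (2 * H)))/=.
move=> E; rewrite -subr_ge0 -sumrB.
have -> : \sum_(k < N) (\sum_(l < N) ((t ^+ 2 + (z k - z l) ^+ 2) `^ H
      - ((z k - z l) ^+ 2) `^ H) - \sum_(l < N) ((pi ^+ 2 + (z k - z l) ^+ 2) `^ H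
      - ((pi - t) ^+ 2 + (z k - z l) ^+ 2) `^ H)) =
   4^-1 * - \sum_(k < N) \sum_u \sum_j c (k, u) * c j * mdist (x (k, u)) (x j) `^ (2 * H).
  rewrite -sumrN mulr_sumr; apply: eq_bigr => k _.
  under [in RHS]eq_bigr => u _ do
    rewrite -(pair_bigA _ (fun l v =>
      c (k, u) * c (l, v) * mdist (x (k, u)) (x (l, v)) `^ (2 * H)))/=.
  rewrite -sumrB exchange_big/= -sumrN mulr_sumr; apply: eq_bigr => l _.
  have dE u v : mdist (x (k, u)) (x (l, v)) `^ (2 * H) =
     ((if u.1 == v.1 then (if u.2 == v.2 then 0 else t)
    else (if u.2 == v.2 then pi else pi - t)) ^+ 2 + (z k - z l) ^+ 2) `^ H.
    rewrite /mdist/= /cylinder_dist/= circle_dist_antipodal_dipoles//.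
    by rewrite sqrt_powR2 ?addr_ge0 ?sqr_ge0// real_normK ?num_real.
  under eq_bigr => u _ do under eq_bigr => v _ do rewrite dE.
  rewrite !sum4 /c/= expr0n/= add0r.
  by field.
by rewrite mulr_ge0// oppr_ge0.
Qed.

(** The interaction of antipodal dipoles is linear in their width, uniformly in
   the (squared) vertical offset s: the corner of the distance at the antipode is
   not smoothed out by moving vertically. *)
Lemma antipodal_gain_ge (R : realType) (H t s : R) : 0 < H <= 1 -> 0 < t <= 1 -> 0 <= s <= 1 ->
  H / (2 * (pi ^+ 2 + 1)) * t <= (pi ^+ 2 + s) `^ H - ((pi - t) ^+ 2 + s) `^ H.
Proof.
move=> HH /andP[t0 t1] /andP[s0 s1].
have p2 := pi_ge2 R.
have A0 : 1 <= pi ^+ 2 + s :> R by nra.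
have B0 : 0 < (pi - t) ^+ 2 + s by nra.
have BA : (pi - t) ^+ 2 + s <= pi ^+ 2 + s by nra.
apply: le_trans (powR_sub_ge HH _ A0); last by rewrite B0.
have /andP[H0 _] := HH.
have D : t <= pi ^+ 2 + s - ((pi - t) ^+ 2 + s) by nra.
rewrite mulrAC ler_pM ?mulr_ge0 ?invr_ge0 ?(ltW H0) ?(ltW t0)//; [nra|nra|].
by rewrite lef_pV2 ?posrE; nra.
Qed.

(** The vertical smoothing: twice this sum, times t^(2H), bounds each row sum of
   the self-interaction of a dipole column of mesh t with n.+1 heights. *)
Lemma sum_powR_incr_le (R : realType) (H : R) (n : nat) : 0 < H <= 2^-1 ->
  \sum_(0 <= j < n.+1) ((1 + j%:R ^+ 2) `^ H - (j%:R ^+ 2) `^ H) <= 4 * n.+1%:R `^ H :> R.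
Proof.
move=> HH; have /andP[H0 H1] := HH.
rewrite big_nat_recl//= expr0n/= addr0 powR1 powR0 ?gt_eqF// subr0.
have N1 : 1 <= n.+1%:R `^ H :> R.
  by rewrite -[leLHS](powRr0 n.+1%:R) ler_powR ?ler1n// ltW.
suff : \sum_(0 <= j < n) ((1 + j.+1%:R ^+ 2) `^ H - (j.+1%:R ^+ 2) `^ H) <=
    n.+1%:R `^ H * 3 :> R.
  by lra.
apply: (@le_trans _ _ (n.+1%:R `^ H * \sum_(0 <= j < n) (j.+1%:R * Num.sqrt j.+1%:R)^-1)).
  rewrite mulr_sumr; apply: ler_sum_nat => j /andP[_ jn].
  by apply: (powR_incr_le HH); rewrite ler1n/= ler_nat ltnS ltnW.
by rewrite ler_wpM2l ?powR_ge0 ?sum_inv_mul_sqrt_le3.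
Qed.

(** * Failure of negative definiteness *)

(** Heights and dipoles have the same mesh t = e / (2 N): after division by N,
   C is at least c (N t) = c e / 2, while L is at most
   8 (t^2 N)^H <= 8 N^(-H), which is smaller once N^H >= 17 / (c e). *)
Lemma not_negative_definite_le_half (R : realType) (eps H : R) : 0 < eps -> 0 < H <= 2^-1 ->
  ~ negative_definite_kernel (fun x y : cylinder eps => mdist x y `^ (2 * H)).
Proof.
move=> eps0 HH nd; have /andP[H0 H1] := HH.
have p2 := pi_ge2 R.
(* The cap at 1 keeps all squared height differences in [0, 1]. *)
have [e [e0 e1 eeps]] : exists e : R, [/\ 0 < e, e <= 1 & e <= eps].
  by exists (Num.min eps 1); rewrite lt_min eps0 ltr01 !ge_min !lexx orbT.
pose c : R := H / (2 * (pi ^+ 2 + 1)).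
have c0 : 0 < c by rewrite /c divr_gt0//; nra.
pose K : R := 17 / (c * e).
have K0 : 0 < K by rewrite divr_gt0// mulr_gt0.
have [n Kn] : exists n : nat, K <= n.+1%:R `^ H.
  exists (Num.truncn (K `^ H^-1)).
  have KE : K = (K `^ H^-1) `^ H.
    by rewrite -powRrM mulVf ?gt_eqF// powRr1// ltW.
  rewrite [leLHS]KE.
  apply: ge0_ler_powR; rewrite ?nnegrE ?powR_ge0 ?ler0n ?(ltW H0)//.
  by rewrite ltW// truncnS_gt.
set N : R := n.+1%:R in Kn.
have N1 : 1 <= N by rewrite ler1n.
pose t := e / (2 * N).
have t0 : 0 < t by rewrite divr_gt0//; lra.
have Nt : N * t = e / 2 by rewrite /t; field; lra.
have t1 : t <= 2^-1 by nra.
pose z (k : 'I_n.+1) : R := k.+1%:R * t.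
pose d (k l : nat) : nat := ((k - l) + (l - k))%N.
have zz k l : (z k - z l) ^+ 2 = (d k l)%:R ^+ 2 * t ^+ 2.
  rewrite /z -mulrBl exprMn; congr (_ * _).
  rewrite /d; case: (leqP k l) => kl.
    rewrite (eqP (_ : (k - l)%N == 0%N)) ?subn_eq0// add0n natrB//.
    by rewrite -[k.+1]addn1 -[l.+1]addn1 !natrD; ring.
  rewrite (eqP (_ : (l - k)%N == 0%N)) ?subn_eq0 1?ltnW// addn0 natrB 1?ltnW//.
  by rewrite -[k.+1]addn1 -[l.+1]addn1 !natrD; ring.
have zin k : 0 < z k <= e / 2.
  by rewrite /z mulr_gt0 ?ltr0n//= -Nt ler_pM2r// ler_nat.
have := @negative_definite_dipole_energy R eps H t n.+1 z nd.
have tpi : 0 < t < pi by rewrite t0/=; lra.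
have zeps k : 0 < z k < eps by have /andP[-> ?]/= := zin k; lra.
move=> /(_ tpi zeps); apply/negP; rewrite -ltNge.
have up : \sum_(k < n.+1) \sum_(l < n.+1) ((t ^+ 2 + (z k - z l) ^+ 2) `^ H
      - ((z k - z l) ^+ 2) `^ H) <= N * ((t ^+ 2) `^ H * (2 * (4 * N `^ H))).
  rewrite /N mulr_natl -[X in _ *+ X](card_ord n.+1) -sumr_const.
  apply: ler_sum => k _.
  pose g (j : nat) : R := (1 + j%:R ^+ 2) `^ H - (j%:R ^+ 2) `^ H.
  have g0 j : 0 <= g j.
    rewrite subr_ge0; apply: ge0_ler_powR; rewrite ?nnegrE ?addr_ge0 ?sqr_ge0 ?(ltW H0)//.
    by rewrite lerDr.
  have -> : \sum_(l < n.+1) ((t ^+ 2 + (z k - z l) ^+ 2) `^ H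
      - ((z k - z l) ^+ 2) `^ H) = (t ^+ 2) `^ H * \sum_(0 <= l < n.+1) g (d k l).
    rewrite big_mkord mulr_sumr; apply: eq_bigr => l _; rewrite zz /g mulrBr.
    rewrite -!powRM ?sqr_ge0 ?addr_ge0 ?sqr_ge0//.
    by congr (_ `^ _ - _ `^ _); ring.
  rewrite ler_wpM2l ?powR_ge0//.
  apply: (le_trans (row_sum_dist_le g0 (ltn_ord k))).
  by rewrite ler_pM2l// sum_powR_incr_le.
apply: (le_lt_trans up).
have low : N * (N * (c * t)) <= \sum_(k < n.+1) \sum_(l < n.+1)
    ((pi ^+ 2 + (z k - z l) ^+ 2) `^ H - ((pi - t) ^+ 2 + (z k - z l) ^+ 2) `^ H).
  rewrite /N mulr_natl -[X in _ *+ X](card_ord n.+1) -sumr_const.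
  apply: ler_sum => k _.
  rewrite mulr_natl -[X in _ *+ X](card_ord n.+1) -sumr_const.
  apply: ler_sum => l _.
  apply: antipodal_gain_ge.
  - by rewrite H0; lra.
  - by rewrite t0; lra.
  rewrite sqr_ge0/=.
  by have /andP[? ?] := zin k; have /andP[? ?] := zin l; nra.
apply: lt_le_trans low.
rewrite ltr_pM2l; last by apply: lt_le_trans N1.
have -> : N * (c * t) = c * e / 2 by rewrite mulrCA Nt mulrA.
have tN : (t ^+ 2) `^ H * N `^ H <= K^-1.
  rewrite -powRM ?sqr_ge0//.
  apply: (@le_trans _ _ (N^-1 `^ H)).
    apply: ge0_ler_powR; rewrite ?nnegrE ?(ltW H0) ?(mulr_ge0 (sqr_ge0 t)) ?invr_ge0//.
    rewrite -[leRHS]mul1r ler_pdivlMr; last by lra.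
    by rewrite (_ : _ * _ * _ = (N * t) ^+ 2); [rewrite Nt expr_le1//; lra|ring].
  rewrite -powR_inv1// -powRrM mulN1r powRN lef_pV2 ?posrE//.
  exact: lt_le_trans Kn.
apply: (@le_lt_trans _ _ (8 * K^-1)); first by lra.
rewrite /K invf_div; have : 0 < c * e by rewrite mulr_gt0.
by lra.
Qed.

(** Four equidistant points on a horizontal circle suffice: there C <= L reads
   pi^(2H) <= 2 (pi / 2)^(2H), which fails as 2^(2H) > 2. *)
Lemma not_negative_definite_gt_half (R : realType) (eps H : R) : 0 < eps -> 2^-1 < H ->
  ~ negative_definite_kernel (fun x y : cylinder eps => mdist x y `^ (2 * H)).
Proof.
move=> eps0 H1 nd; have p2 := pi_ge2 R.
have tpi : 0 < (pi / 2 : R) < pi by apply/andP; split; lra.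
have zeps (k : 'I_1) : 0 < eps / 2 < eps by apply/andP; split; lra.
have {zeps} := negative_definite_dipole_energy nd tpi zeps.
rewrite !big_ord1 subrr expr0n/= !addr0 powR0; last by lra.
rewrite (_ : pi - pi / 2 = pi / 2); last by lra.
rewrite subr0 lerBlDr; apply/negP; rewrite -ltNge.
have h0 : 0 < ((pi / 2) ^+ 2) `^ H :> R by rewrite powR_gt0// exprn_gt0//; lra.
have -> : pi ^+ 2 = 2 ^+ 2 * (pi / 2) ^+ 2 :> R by field.
rewrite powRM ?sqr_ge0//.
have : 2 < (2 ^+ 2) `^ H :> R.
  rewrite -[2 ^+ 2](powR_mulrn 2)// -powRrM.
  rewrite -[ltLHS](@powRr1 R 2)// /powR pnatr_eq0/= ltr_expR ltr_pM2r ?ln_gt0 ?ltr1n//.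
  by lra.
by nra.
Qed.

(** * Fractional Brownian fields *)

Lemma sum_sqr_dist (R : comPzRingType) (n : nat) (c y : 'I_n -> R) :
  \sum_(i < n) c i = 0 ->
  \sum_(i < n) \sum_(j < n) c i * c j * (y i - y j) ^+ 2 =
  - (2 * (\sum_(i < n) c i * y i) ^+ 2).
Proof.
move=> c0; set S1 := \sum_(i < n) c i * y i.
pose S2 := \sum_(j < n) c j * y j ^+ 2.
have row i : \sum_(j < n) c i * c j * (y i - y j) ^+ 2 =
    c i * S2 - 2 * (c i * y i) * S1.
  have <- : \sum_(j < n) c i * c j * (y i - y j) ^+ 2 - c i * y i ^+ 2 * \sum_(j < n) c j =
      c i * S2 - 2 * (c i * y i) * S1.
    by rewrite /S1 /S2 !mulr_sumr -!sumrB; apply: eq_bigr => j _; ring.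
  by rewrite c0 mulr0 subr0.
under eq_bigr => i _ do rewrite row.
by rewrite sumrB -mulr_suml c0 mul0r add0r -mulr_suml -mulr_sumr -mulrA.
Qed.

(** Integrating [sum_sqr_dist] along the field gives the quadratic form; the
   squared increments are integrable because their expectations are finite. *)
Lemma fractional_brownian_negative_definite (R : realType) (E : metricType R) (H : R)
    (d : measure_display) (T : measurableType d) (P : probability T R)
    (X : E -> {RV P >-> R}) :
  fractional_brownian_field H X ->
  negative_definite_kernel (fun x y : E => mdist x y `^ (2 * H)).
Proof.
move=> [_ _ var]; split=> [x y|n x c c0]; first by rewrite metric_sym.
pose Y i j w := (X (x i) w - X (x j) w) ^+ 2.
have mY i j : measurable_fun setT (Y i j).
  by apply: measurable_funX; apply: measurable_funB.
have EY i j : (\int[P]_w (Y i j w)%:E = (mdist (x i) (x j) `^ (2 * H))%:E)%E.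
  by rewrite -var unlock.
have iY i j : P.-integrable setT (EFin \o Y i j).
  apply/integrableP; split; first exact/measurable_EFinP.
  under eq_integral => w _ do rewrite /= ger0_norm ?sqr_ge0//.
  by rewrite EY ltry.
have icY i j : P.-integrable setT (fun w => (c i * c j)%:E * (Y i j w)%:E)%E.
  exact: (integrableZl measurableT _ (iY i j)).
have quad w : \sum_(i < n) \sum_(j < n) c i * c j * Y i j w =
    - (2 * (\sum_(i < n) c i * X (x i) w) ^+ 2).
  exact: (sum_sqr_dist (fun i => X (x i) w) c0).
rewrite -lee_fin.
have -> : ((\sum_(i < n) \sum_(j < n) c i * c j * mdist (x i) (x j) `^ (2 * H))%:E =
    \int[P]_w (\sum_(i < n) \sum_(j < n) c i * c j * Y i j w)%:E)%E.
  under [RHS]eq_integral => w _.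
    rewrite -sumEFin. under eq_bigr => i _ do rewrite -sumEFin.
    over.
  rewrite integral_sum//; last by move=> i; apply: integrable_sum => // j _; exact: icY.
  rewrite -sumEFin; apply: eq_bigr => i _.
  rewrite integral_sum//; last by move=> j; exact: icY.
  rewrite -sumEFin; apply: eq_bigr => j _.
  under eq_integral => w _ do rewrite EFinM.
  by rewrite (integralZl measurableT (iY i j)) EFinM; congr (_ * _)%E; rewrite -EY.
have sq0 w : (0 <= (2 * (\sum_(i < n) c i * X (x i) w) ^+ 2)%:E)%E.
  by rewrite lee_fin mulr_ge0// sqr_ge0.
under eq_integral => w _ do rewrite quad EFinN.
by rewrite integral_ge0N// oppe_le0 integral_ge0.
Qed.

(** * The fractional index of the cylinder *)

Theorem theorem1 (R : realType) (eps : R) (heps : 0 < eps) :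
  (forall H : R, 0 < H ->
     ~ negative_definite_kernel
         (fun x y : cylinder eps => mdist x y `^ (2 * H)) /\
     forall (d : measure_display) (T : measurableType d) (P : probability T R)
       (X : cylinder eps -> {RV P >-> R}), ~ fractional_brownian_field H X) /\
  fractional_index (cylinder eps) = 0%E.
Proof.
have nnd (H : R) : 0 < H ->
    ~ negative_definite_kernel (fun x y : cylinder eps => mdist x y `^ (2 * H)).
  move=> H0; case: (lerP H 2^-1) => H1.
    by apply: not_negative_definite_le_half; rewrite // H0.
  exact: not_negative_definite_gt_half.
split=> [H H0|].
  split; first exact: nnd.
  by move=> d T P X /fractional_brownian_negative_definite; exact: nnd.
apply: xget_unique => [|beta [beta0 betaP]].
  split=> // H H0; split=> [/(nnd _ H0)//|].
  by rewrite lee_fin => ?; exfalso; lra.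
case: (eqVneq beta 0%E) => // bneq0.
have b0 : (0 < beta)%E by rewrite lt_neqAle eq_sym bneq0.
(* A real witness is needed because beta may be +oo. *)
have [r r0 rb] : exists2 r : R, 0 < r & (r%:E <= beta)%E.
  case: beta b0 {beta0 betaP bneq0} => [r| |]; rewrite ?lte_fin// => r0.
    by exists r.
  by exists 1; rewrite ?leey.
exfalso; have r20 : 0 < r / 2 by lra.
apply: (nnd _ r20); apply/(betaP _ r20).
by rewrite (_ : 2 * (r / 2) = r)//; field.
Qed.
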